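(* Let $G=(V,E)$ be a finite, simple, connected, undirected graph with $n\ge 2$ nodes, and let $t$ be an integer with $0\le t<\kappa(G)$. Then no oblivious algorithm solves consensus in $G$ under the $t$-resilient model (i.e. for all input assignments and all failure patterns in $\Phi^{(t)}_{\mathrm{all}}$) in fewer than $\mathrm{radius}(G,t)$ rounds.
   Context: Model. $G=(V,E)$ is a finite simple connected undirected graph whose nodes carry distinct identifiers; $N(v)$ denotes the neighbourhood of $v$ and $\kappa(G)$ the vertex connectivity of $G$ (minimum number of nodes whose removal disconnects $G$ or leaves a single node). Computation proceeds in synchronous rounds $1,2,\dots$: in each round every node sends a message to each neighbour, receives the messages of its neighbours, and computes. Every node knows $G$ and $t$ in advance. Failure patterns. For an integer $t\ge 0$, a failure pattern is a set $\varphi=\{(v,F_v,f_v): v\in F\}$ with $F\subseteq V$, $|F|\le t$, and for each $v\in F$ an integer $f_v\ge 1$ and a nonempty set $F_v\subseteq N(v)$: node $v$ behaves normally in rounds $1,\dots,f_v-1$, in round $f_v$ its messages reach exactly the neighbours in $N(v)\setminus F_v$, and afterwards it sends nothing. Nodes of $F$ are faulty, nodes of $V\setminus F$ are correct in $\varphi$. $\Phi^{(t)}_{\mathrm{all}}$ is the set of all failure patterns with at most $t$ faulty nodes. Causal paths and eccentricity. A causal path w.r.t. $\varphi$ from $v$ to $v'$ is a sequence $u_1=v,u_2,\dots,u_q=v'$ with $u_{i+1}\in N(u_i)$ such that for each $i<q$, $u_i$ has not crashed during rounds $1,\dots,i-1$, and if $u_i$ crashes at round $i$ (i.e. $(u_i,F_{u_i},i)\in\varphi$)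 then $u_{i+1}\notin F_{u_i}$; its length is $q-1$. $\mathrm{ecc}(v,\varphi)$ is the maximum, over all correct nodes $v'$ of $\varphi$, of the minimum length of a causal path w.r.t. $\varphi$ from $v$ to $v'$ (this is $\infty$ if some correct node has no such path). Let $\Phi^\star_v=\{\varphi\in\Phi^{(t)}_{\mathrm{all}}:\mathrm{ecc}(v,\varphi)<\infty\}$ and $\mathrm{radius}(G,t)=\min_{v\in V}\max_{\varphi\in\Phi^\star_v}\mathrm{ecc}(v,\varphi)$. Views and oblivious algorithms. Each node $u$ has an input $x_u$; in the flooding protocol every node sends $(u,x_u)$ in round 1 and in each later round forwards all pairs it knows. $\mathrm{view}(v,r,\varphi)$ is the set of pairs $(u,x_u)$ known to $v$ after $r$ rounds under $\varphi$; $(u,x_u)\in \mathrm{view}(v,r,\varphi)$ iff $u=v$ or there is a causal path w.r.t. $\varphi$ from $u$ to $v$ of length at most $r$. An oblivious algorithm running in $r$ rounds performs this flooding for $r$ rounds, after which each correct node $v$ outputs a value depending only on $v$ and the set $\mathrm{view}(v,r,\varphi)$. Consensus. Inputs are taken from a set $I$ with $|I|\ge2$; every correct node $v$ must output $y_v\in I$ such that all correct nodes output the same value (agreement) and each output equals $x_u$ for some node $u$ (validity). *)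

(* Defs.v *)
From mathcomp Require Import all_boot.
From Stdlib Require Import ClassicalEpsilon.

Set Implicit Arguments.
Unset Strict Implicit.
Unset Printing Implicit Defensive.

Section Defs.

Variable T : finType.
(* the graph G = (V,E): V = T, E given by a symmetric irreflexive relation e *)
Variable e : rel T.

Definition nbhd (v : T) : {set T} := [set w | e v w].

Definition induced_rel (S : {set T}) : rel T :=
  [rel x y | [&& x \notin S, y \notin S & e x y]].

Definition separating (S : {set T}) : bool :=
  (#|~: S| <= 1) ||
  ~~ [forall x in ~: S, forall y in ~: S, connect (induced_rel S) x y].

(* minimum size of such a set (setT is always separating, so this is a
   true minimum) *)
Definition kappa : nat := \big[minn/#|T|]_(S : {set T} | separating S) #|S|.

(* pfaulty = F, pset v = F_v, pround v = f_v ; the last two are only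
   meaningful for v \in F *)
Record pattern := Pattern {
  pfaulty : {set T};
  pset : T -> {set T};
  pround : T -> nat }.

Definition valid_pattern (t : nat) (phi : pattern) : Prop :=
  #|pfaulty phi| <= t /\
  forall v, v \in pfaulty phi ->
    [/\ 1 <= pround phi v, pset phi v != set0 & pset phi v \subset nbhd v].

(* cpath phi r u s : the sequence u :: s is a causal path, where u is its
   r-th node (1-indexed), i.e. u sends along the next edge in round r. *)
Fixpoint cpath (phi : pattern) (r : nat) (u : T) (s : seq T) : bool :=
  match s with
  | [::] => true
  | w :: s' =>
    [&& e u w,
        ~~ ((u \in pfaulty phi) && (pround phi u < r)),      (* not crashed in rounds 1..r-1 *)
        ((u \in pfaulty phi) && (pround phi u == r)) ==> (w \notin pset phi u)
      & cpath phi r.+1 w s']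
  end.

Definition path_within (phi : pattern) (u v : T) (r : nat) : bool :=
  [exists k : 'I_r.+1, [exists s : k.-tuple T,
     cpath phi 1 u s && (last u s == v)]].

Definition pb (P : Prop) : bool :=
  if excluded_middle_informative P then true else false.

Definition ecc_le (phi : pattern) (v : T) (r : nat) : bool :=
  [forall w, (w \notin pfaulty phi) ==> path_within phi v w r].

Definition ecc_finite (phi : pattern) (v : T) : Prop := exists r, ecc_le phi v r.

(* ecc(v,phi) when finite (value 0 is a dummy for the infinite case, which
   is never used below) *)
Definition ecc (phi : pattern) (v : T) : nat :=
  match excluded_middle_informative (ecc_finite phi v) with
  | left H => ex_minn H
  | right _ => 0
  end.

Definition in_Phi_star (t : nat) (v : T) (phi : pattern) : Prop :=
  valid_pattern t phi /\ ecc_finite phi v.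

(* max_{phi in Phi*_v} ecc(v,phi), as the least upper bound in nat;
   None = infinite (unbounded) *)
Definition max_ecc (t : nat) (v : T) : option nat :=
  match excluded_middle_informative
          (exists B, pb (forall phi, in_Phi_star t v phi -> ecc phi v <= B)) with
  | left H => Some (ex_minn H)
  | right _ => None
  end.

(* radius(G,t) = min_v max_{phi in Phi*_v} ecc(v,phi); None = infinite *)
Definition radius (t : nat) : option nat :=
  match excluded_middle_informative
          (exists R, [exists v, max_ecc t v == Some R]) with
  | left H => Some (ex_minn H)
  | right _ => None
  end.

Definition lt_radius (r : nat) (R : option nat) : bool :=
  if R is Some R' then r < R' else true.

Variable I : Type.

(* view(v,r,phi) for the input assignment x, encoded as the partial function
   u |-> Some (x u) if (u, x u) is in the view, None otherwise *)
Definition view (phi : pattern) (x : T -> I) (v : T) (r : nat)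
  : {ffun T -> option I} :=
  [ffun u => if (u == v) || path_within phi u v r then Some (x u) else None].

Definition oblivious_solves_consensus (t r : nat)
  (out : T -> {ffun T -> option I} -> I) : Prop :=
  forall (x : T -> I) (phi : pattern), valid_pattern t phi ->
    (forall v w, v \notin pfaulty phi -> w \notin pfaulty phi ->
       out v (view phi x v r) = out w (view phi x w r)) /\
    (forall v, v \notin pfaulty phi -> exists u, out v (view phi x v r) = x u).

End Defs.

(* Main.v *)
From mathcomp Require Import all_boot zify.
From Stdlib Require Import ClassicalEpsilon.
Require Import Defs.

(** If [r] is less than the radius, every node [v] has a failure pattern in
    which after [r] rounds some correct node [w] has not heard from [v] but some
    other correct node has. Choose one with crashes as late as possible: then
    each crashing node [u] has heard from [v] exactly one round before its
    crash, and has a relay, that is, a neighbour that hears from [v] by the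
    round in which [u] crashes and that survives this round.

    From such a pattern all crashes can be postponed beyond round [r], starting
    with the latest ones, without changing the decision. Whether [u] informs its
    relay is not noticed by [w], provided the later crashes are temporarily
    moved back as early as possible. Once the relay, with its own crash
    temporarily removed, is informed, it does not notice whether [u] informs its
    other neighbours. So the decision is the one of the failure-free execution,
    and since [w] has not heard from [v] it does not depend on the input of [v].
    As [v] is arbitrary, the decision is constant, contradicting validity. *)

Set Implicit Arguments.
Unset Strict Implicit.
Unset Printing Implicit Defensive.

Section DynamicGraph.

Variable T : finType.
(* [D i u x] says that the message of [u] to [x] arrives in round [i >= 1]. *)
Implicit Types (D : nat -> rel T) (v u x : T).

Fixpoint informed D v i : {set T} :=
  if i is j.+1 then
    informed D v j :|: [set x | [exists u in informed D v j, D j.+1 u x]]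
  else [set v].

Lemma informedSP D v i x :
  reflect (x \in informed D v i \/ exists2 u, u \in informed D v i & D i.+1 u x)
          (x \in informed D v i.+1).
Proof.
rewrite /= !inE; apply: (iffP orP) => -[hx|hx]; [by left| |by left|].
  by right; apply/exists_inP.
by right; apply/exists_inP.
Qed.

Lemma informed_step D v i u x :
  u \in informed D v i -> D i.+1 u x -> x \in informed D v i.+1.
Proof. by move=> hu hux; apply/informedSP; right; exists u. Qed.

Lemma informed_mono D v i j :
  i <= j -> {subset informed D v i <= informed D v j}.
Proof.
move=> /subnK <-; elim: (j - i) => // k IH x /IH hx.
by apply/informedSP; left.
Qed.

Lemma informed_source D v i : v \in informed D v i.
Proof. by apply: (informed_mono (leq0n i)); rewrite inE. Qed.

Lemma informed_ind D v k (P : nat -> T -> Prop) :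
  P 0 v ->
  (forall i x, i < k -> P i x -> P i.+1 x) ->
  (forall i u x, i < k -> u \in informed D v i -> P i u -> D i.+1 u x ->
     P i.+1 x) ->
  forall x, x \in informed D v k -> P k x.
Proof.
move=> P0 Pstay Pstep; have: k <= k by [].
elim: {-2}k => [|i IH] ik x; first by rewrite inE => /eqP->.
case/informedSP=> [/(IH (ltnW ik))|[u hu]]; first exact: Pstay.
exact: Pstep (IH (ltnW ik) u hu).
Qed.

Lemma sub_informed D D' v k :
  (forall i u x, i < k -> u \in informed D v i -> u \in informed D' v i ->
     D i.+1 u x -> x \in informed D' v i.+1) ->
  {subset informed D v k <= informed D' v k}.
Proof.
move=> step.
apply: (informed_ind (P := fun i x => x \in informed D' v i)) => //.
- exact: informed_source.
- by move=> i x _; apply: informed_mono.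
Qed.

Lemma sub_informed_rel D D' v k :
  (forall i, i < k -> subrel (D i.+1) (D' i.+1)) ->
  {subset informed D v k <= informed D' v k}.
Proof.
move=> sDD'; apply: sub_informed => i u x ik _ hu /(sDD' i ik).
exact: informed_step.
Qed.

Lemma eq_informed D D' v k :
  (forall i, i < k -> D i.+1 =2 D' i.+1) -> informed D v k = informed D' v k.
Proof.
move=> eDD'; apply/setP=> x; apply/idP/idP; apply: sub_informed_rel => i ik u z.
  by rewrite eDD'.
by rewrite eDD'.
Qed.

Lemma informed_progress D v i j x :
  x \in informed D v j -> x \notin informed D v i ->
  exists k u z, [/\ i <= k, u \in informed D v i & D k.+1 u z].
Proof.
elim: j x => [|j IH] x xj xi.
  by move: xj xi; rewrite inE => /eqP->; rewrite informed_source.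
case/informedSP: (xj) => [xj'|[u uj ux]]; first exact: IH xi.
case: (boolP (u \in informed D v i)) => [ui|]; last exact: IH.
exists j, u, x; split=> //; rewrite -ltnS ltnNge.
by apply: contra xi => ji; apply: informed_mono xj.
Qed.

Lemma informed_extra_edges D D' B a v h k x :
  (forall i u z, i < k -> D' i.+1 u z ->
     D i.+1 u z \/ i.+1 = h /\ z \in informed B v h) ->
  (forall i, h <= i < k -> subrel (D' i.+1) (B i.+1)) ->
  x \in informed D' a k -> x \in informed D a k \/ x \in informed B v k.
Proof.
move=> D'D D'B xk.
suff: x \in informed D a k \/ h <= k /\ x \in informed B v k.
  by case=> [|[_]]; [left|right].
pose P i z := z \in informed D a i \/ h <= i /\ z \in informed B v i.
apply: (@informed_ind D' a k P) xk => [|i z _|i u z ik _].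
- by left; apply: informed_source.
- case=> [zi|[hi zi]]; [left|right; split].
  + exact: informed_mono zi.
  + exact: leqW.
  + exact: informed_mono zi.
- case=> [ui|[hi ui]] uz.
    case: (D'D _ _ _ ik uz) => [uz'|[ih zh]]; last by right; rewrite ih.
    by left; apply: informed_step uz'.
  right; split; first exact: leqW.
  by apply: informed_step ui _; apply: D'B uz; rewrite hi.
Qed.

End DynamicGraph.

Arguments informed {T} D v i : simpl never.

Section Graph.

Variables (T : finType) (e : rel T).
Implicit Types (phi : pattern T) (u v w x y z : T).

Definition pattern_delivers phi i u x :=
  [&& e u x, ~~ ((u \in pfaulty phi) && (pround phi u < i))
    & ((u \in pfaulty phi) && (pround phi u == i)) ==> (x \notin pset phi u)].

Lemma cpath_rcons phi i u s x :
  cpath e phi i u (rcons s x) =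
  cpath e phi i u s && pattern_delivers phi (i + size s) (last u s) x.
Proof.
elim: s i u => [|y s IH] i u /=; first by rewrite addn0 !andbT.
by rewrite IH addSnnS -!andbA.
Qed.

Lemma leq_pattern_delivers phi i j u x :
  i <= j -> pattern_delivers phi j u x -> pattern_delivers phi i u x.
Proof.
rewrite /pattern_delivers leq_eqVlt => /predU1P[-> //|ij] /and3P[-> alive _].
by case: (u \in pfaulty phi) alive => //=; lia.
Qed.

Lemma cpathP phi v i x :
  reflect (exists2 s, size s <= i & cpath e phi 1 v s /\ last v s = x)
          (x \in informed (pattern_delivers phi) v i).
Proof.
apply: (iffP idP) => [|[s + [+ <-]]].
  elim: i x => [|i IH] x; first by rewrite inE => /eqP->; exists [::].
  case/informedSP=> [/IH[s si sP]|[u /IH[s si [vs lu]] ux]].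
    by exists s => //; apply: leqW.
  exists (rcons s x); rewrite ?size_rcons // last_rcons cpath_rcons vs lu.
  by split=> //; apply: leq_pattern_delivers ux.
move=> /informed_mono si vs; apply: si.
elim/last_ind: s vs => [|s z IH]; first by rewrite informed_source.
rewrite cpath_rcons last_rcons size_rcons => /andP[/IH hs].
exact: informed_step.
Qed.

Lemma path_withinP phi v x r :
  reflect (exists2 s, size s <= r & cpath e phi 1 v s /\ last v s = x)
          (path_within e phi v x r).
Proof.
apply: (iffP existsP) => [[k /existsP[s /andP[vs /eqP lx]]]|[s sr [vs lx]]].
  by exists (tval s) => //; rewrite size_tuple -ltnS.
have ltsr : size s < r.+1 by [].
exists (Ordinal ltsr); apply/existsP; exists (in_tuple s).
by rewrite vs lx /=.
Qed.

Lemma path_within_informed phi v x r :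
  path_within e phi v x r = (x \in informed (pattern_delivers phi) v r).
Proof. by apply/path_withinP/cpathP. Qed.

Lemma view_informed (I : Type) phi (x : T -> I) v r :
  view e phi x v r =
  [ffun u => if v \in informed (pattern_delivers phi) u r
             then Some (x u) else None].
Proof.
apply/ffunP=> u; rewrite !ffunE path_within_informed.
by case: eqP => // ->; rewrite informed_source.
Qed.

(* In an execution of [r] rounds, a crash after round [r] means no crash. *)
Record schedule := Schedule {
  crash : T -> nat;
  lost : T -> {set T} }.

Implicit Types s : schedule.

Definition delivers s i u x :=
  [&& e u x, i <= crash s u & (i == crash s u) ==> (x \notin lost s u)].

Definition no_crash r := Schedule (fun=> r.+1) (fun=> set0).

(* A crash that loses no message is presented as a crash one round later that
   loses all of them, because the sets F_v of a failure pattern are nonempty. *)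
Definition pattern_of r s : pattern T :=
  let loses u := lost s u :&: nbhd e u in
  Pattern [set u | crash s u <= r]
    (fun u => if loses u == set0 then nbhd e u else loses u)
    (fun u => if loses u == set0 then (crash s u).+1 else crash s u).

Lemma pattern_delivers_of r s i :
  0 < i <= r -> pattern_delivers (pattern_of r s) i =2 delivers s i.
Proof.
move=> /andP[i_gt0 ir] u x; rewrite /pattern_delivers /delivers /= inE.
case ux: (e u x) => //=.
case: ifP => [/eqP/setP/(_ x)|_]; rewrite !inE ux !andbT ?andbF.
  by move=> ->; rewrite implybT; lia.
by case: (x \in lost s u); lia.
Qed.

Lemma view_pattern_of (I : Type) (x : T -> I) r s v :
  view e (pattern_of r s) x v r =
  [ffun u => if v \in informed (delivers s) u r then Some (x u) else None].
Proof.
rewrite view_informed; apply/ffunP=> u; rewrite !ffunE.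
rewrite (eq_informed (D' := delivers s)) // => i ir.
exact: pattern_delivers_of.
Qed.

Lemma valid_pattern_of t r s :
  #|[set u | crash s u <= r]| <= t ->
  (forall u, crash s u <= r -> 0 < crash s u /\ nbhd e u != set0) ->
  valid_pattern e t (pattern_of r s).
Proof.
move=> st s_nbhd; split=> // u; rewrite /= inE => /s_nbhd[s_gt0 nb].
case: ifP => [_|/negbT loses]; first by split.
by split=> //; apply: subsetIr.
Qed.

Lemma valid_no_crash t r : valid_pattern e t (pattern_of r (no_crash r)).
Proof.
apply: valid_pattern_of => [|u] /=; last by rewrite ltnn.
by rewrite leqNgt (eq_card0 (A := [set u | _])) // => u; rewrite inE ltnn.
Qed.

Definition schedule_of r phi :=
  Schedule (fun u => if u \in pfaulty phi then minn (pround phi u) r.+1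
                     else r.+1)
           (pset phi).

Lemma delivers_schedule_of r phi i :
  i <= r -> delivers (schedule_of r phi) i =2 pattern_delivers phi i.
Proof.
move=> ir u x; rewrite /delivers /pattern_delivers /=.
case: (u \in pfaulty phi); case: (e u x) => //=; last by lia.
by case: (x \in pset phi u) => /=; lia.
Qed.

Definition delay s u :=
  Schedule [eta crash s with u |-> (crash s u).+1]
           [eta lost s with u |-> nbhd e u].

Lemma delivers_delay s u i z x :
  delivers (delay s u) i z x =
  delivers s i z x || [&& z == u, i == crash s u & e u x].
Proof.
rewrite /delivers /=; case: (z =P u) => [->|_]; last by rewrite orbF.
by rewrite inE; case: (e u x) => //=; case: (x \in lost s u); lia.
Qed.

Definition inform s u y :=
  Schedule (crash s) [eta lost s with u |-> lost s u :\ y].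

Lemma delivers_inform s u y i z x :
  delivers (inform s u y) i z x =
  delivers s i z x || [&& z == u, x == y, i == crash s u & e u x].
Proof.
rewrite /delivers /=; case: (z =P u) => [->|_]; last by rewrite orbF.
rewrite in_setD1; case: (e u x) => //=; last by rewrite !andbF.
by case: (x == y); case: (x \in lost s u) => /=; lia.
Qed.

(* The round added by the delay is void if [u] has nothing to tell, and
   redundant if [u] has already informed all its neighbours. *)
Lemma informed_delay s u v k :
  (u \in informed (delivers s) v (crash s u).-1 ->
   exists2 i, i.+1 < crash s u & u \in informed (delivers s) v i) ->
  informed (delivers (delay s u)) v k = informed (delivers s) v k.
Proof.
move=> told; apply/setP=> x; apply/idP/idP; last first.
  by apply: sub_informed_rel => i _ z y zy; rewrite delivers_delay zy.
apply: sub_informed => i z y _ _ zi; rewrite delivers_delay.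
case/orP=> [|/and3P[/eqP zu /eqP iu uy]]; first exact: informed_step.
subst z; have [|j ju uj] := told; first by rewrite -iu.
apply: (@informed_mono _ _ _ j.+1); first by rewrite iu ltnW.
by apply: (informed_step uj); rewrite /delivers uy; lia.
Qed.

Section LatestSchedule.

Variables (t r : nat) (v : T).
Hypothesis e_sym : symmetric e.

Local Notation heard s := (informed (delivers s) v).

Definition admissible s :=
  (forall u, 0 < crash s u <= r.+1) /\ #|[set u | crash s u <= r]| <= t.

Definition splits s :=
  exists w y, [/\ r < crash s w, w \notin heard s r,
                  r < crash s y & y \in heard s r].

Definition lost_rounds s := \sum_u (r.+1 - crash s u).

Definition latest s :=
  [/\ admissible s, splits s &
      forall s', admissible s' -> splits s' -> lost_rounds s <= lost_rounds s'].

Lemma latest_exists s : admissible s -> splits s -> exists s', latest s'.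
Proof.
have [n] := ubnP (lost_rounds s); elim: n s => // n IH s lt_n s_adm s_split.
case: (classic (latest s)) => [|not_latest]; first by exists s.
suff [s' [s'_adm s'_split lt_s']] : exists s', [/\ admissible s', splits s' &
    lost_rounds s' < lost_rounds s] by apply: (IH s') => //; lia.
apply: NNPP => none; apply: not_latest; split=> // s' s'_adm s'_split.
by rewrite leqNgt; apply/negP=> lt_s'; apply: none; exists s'.
Qed.

Lemma leq_crash_delay s u z : crash s z <= crash (delay s u) z.
Proof. by rewrite /=; case: eqP => [->|]. Qed.

Lemma admissible_delay s u :
  crash s u <= r -> admissible s -> admissible (delay s u).
Proof.
move=> ur [s_bounds st]; split=> [z|].
  by rewrite /=; case: eqP => // _; rewrite ltnS ur.
apply: leq_trans st; apply/subset_leq_card/subsetP => z; rewrite !inE.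
exact/leq_trans/leq_crash_delay.
Qed.

Lemma lost_rounds_delay s u :
  crash s u <= r -> lost_rounds (delay s u) < lost_rounds s.
Proof.
move=> ur; rewrite /lost_rounds (bigD1 u) //= [ltnRHS](bigD1 u) //= eqxx.
rewrite (eq_bigr (fun z => r.+1 - crash s z)) => [|z /negbTE-> //].
by lia.
Qed.

Lemma latest_informed s u i :
  latest s -> crash s u <= r -> (u \in heard s i) = (crash s u <= i.+1).
Proof.
case=> s_adm s_split s_min ur.
have delay_split : ~ splits (delay s u).
  move=> /(s_min _ (admissible_delay ur s_adm)).
  by rewrite leqNgt lost_rounds_delay.
suff [told early] : u \in heard s (crash s u).-1 /\
    forall j, j.+1 < crash s u -> u \notin heard s j.
  have [ui|/early/negbTE-> //] := leqP (crash s u) i.+1.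
  by apply: informed_mono told; lia.
apply: NNPP => not_fresh; apply: delay_split.
have same : heard (delay s u) r = heard s r.
  apply: informed_delay => told; apply: NNPP => not_early.
  apply: not_fresh; split=> // j ju; apply/negP=> uj.
  by apply: not_early; exists j.
case: s_split => w [y [ws wi ys yi]].
exists w, y; rewrite same; split=> //.
  exact: leq_trans (leq_crash_delay _ _ _).
exact: leq_trans (leq_crash_delay _ _ _).
Qed.

Definition relay_of s u :=
  [pred y | [&& e u y, y \in heard s (crash s u) & crash s u < crash s y]].

Definition has_relay s u := [exists y, relay_of s u y].

Lemma crash_no_relay s u y :
  ~~ has_relay s u -> e u y -> y \in heard s (crash s u) ->
  crash s y <= crash s u.
Proof.
move=> norel uy yi; rewrite leqNgt; apply: contra norel => lt_uy.
by apply/existsP; exists y; rewrite /= uy yi.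
Qed.

Definition hide s u k :=
  Schedule (crash s)
    (fun z => if crash s z == k then u |: lost s z else lost s z).

Lemma delivers_hide s u k i z x :
  delivers (hide s u k) i z x =
  delivers s i z x && ~~ [&& i == k, crash s z == k & x == u].
Proof.
rewrite /delivers /=; case: (crash s z =P k) => [->|_]; last first.
  by rewrite andbF andbT.
rewrite in_setU1 negb_or.
by case: (i == k); case: (x == u); rewrite ?andbT ?andbF.
Qed.

Lemma informed_hide s u k n : {subset heard (hide s u k) n <= heard s n}.
Proof.
by apply: sub_informed_rel => i _ z x; rewrite delivers_hide => /andP[].
Qed.

(* [u] speaks only in the round of its crash, to nodes that do not survive this
   round. *)
Lemma informed_hide_survivor s u k n y :
  ~~ has_relay s u -> (forall i, u \in heard s i -> crash s u <= i.+1) ->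
  crash s u < crash s y -> y \in heard s n -> y \in heard (hide s u k) n.
Proof.
move=> norel u_late uy yn.
suff: [|| y \in heard (hide s u k) n, y == u | crash s y <= crash s u <= n].
  by case/or3P=> // [/eqP yu|]; move: uy; rewrite ?yu; lia.
pose P i z :=
  [|| z \in heard (hide s u k) i, z == u | crash s z <= crash s u <= i].
apply: (@informed_ind _ (delivers s) v n P) yn => [|i z _|i z x _ zi + zx].
- by rewrite /P informed_source.
- case/or3P=> [zi|zu|zu]; apply/or3P; [apply: Or31|exact: Or32|apply: Or33].
    exact: informed_mono zi.
  by lia.
rewrite /P; case: (eqVneq x u) => [_|xu]; first by rewrite orbT.
have /and3P[ezx iz _] := zx.
case/or3P=> [zi'|/eqP zu|]; last by lia.
  apply/orP; left; apply: (informed_step zi').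
  by rewrite delivers_hide zx (negbTE xu) !andbF.
subst z; have iu : i.+1 = crash s u by have := u_late i zi; lia.
have xi := informed_step zi zx; rewrite iu in xi *.
by rewrite (crash_no_relay norel ezx xi) leqnn !orbT.
Qed.

Lemma latest_hide s u k : latest s -> crash s u <= r -> ~~ has_relay s u ->
  latest (hide s u k).
Proof.
move=> s_latest ur norel; case: (s_latest) => s_adm [w [y [ws wi ys yi]]] s_min.
split=> //; exists w, y; split=> //.
  by apply: contra wi; apply: informed_hide.
apply: informed_hide_survivor => //; last exact: leq_ltn_trans ys.
by move=> i; rewrite (latest_informed i s_latest ur).
Qed.

Lemma latest_crash1_has_relay s u :
  latest s -> 0 < r -> crash s u = 1 -> has_relay s u.
Proof.
move=> s_latest r_gt0 u1; apply: contraT => norel.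
have uv : u = v.
  have := latest_informed 0 s_latest (u := u).
  by rewrite u1 inE => /(_ r_gt0)/eqP.
have [_ [_ [y [_ _ ys yi]]] _] := s_latest.
suff: crash s y <= 1 by lia.
apply: (informed_ind (P := fun _ x => crash s x <= 1)) yi => //.
  by rewrite -uv u1.
move=> i z x _ zi z1 zx; have i0 : i = 0 by case/and3P: zx; lia.
subst i; have zu : z = u by move: zi; rewrite inE uv => /eqP.
subst z; have x1 := informed_step zi zx; rewrite -u1 in x1 *.
by apply: crash_no_relay x1 => //; case/and3P: zx.
Qed.

(* Without a relay, all nodes informing [u] crash one round before it, so their
   last messages to [u] can be lost as well: the schedule remains a latest one,
   in which [u] is informed too late for [latest_informed]. *)
Lemma latest_has_relay s u : latest s -> crash s u <= r -> has_relay s u.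
Proof.
move=> s_latest ur.
have [[s_bounds _] _ _] := s_latest.
case uE: (crash s u) => [|[|j]]; first by have := s_bounds u; lia.
  by apply: latest_crash1_has_relay => //; rewrite -uE.
apply: contraT => norel; have hidden := latest_hide j.+1 s_latest ur norel.
have : u \in heard (hide s u j.+1) j.+1.
  by rewrite (latest_informed _ hidden ur) /= uE.
case/informedSP=> [/informed_hide|[p /informed_hide pj]].
  by rewrite (latest_informed _ s_latest ur) uE ltnn.
rewrite delivers_hide !eqxx andbT => /andP[/and3P[pu jp _] pj1].
have pu_le : crash s p <= crash s u.
  apply: (crash_no_relay norel); first by rewrite e_sym.
  by apply: informed_mono pj; lia.
by move: pj; rewrite (latest_informed _ s_latest); move: pj1; lia.
Qed.

Definition relay s u := odflt u (pick (relay_of s u)).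

Lemma relayP s u : has_relay s u ->
  [/\ e u (relay s u), relay s u \in heard s (crash s u) &
      crash s u < crash s (relay s u)].
Proof.
case/existsP=> y yP; rewrite /relay.
by case: pickP => [z /and3P[]|/(_ y)]; rewrite ?yP.
Qed.

End LatestSchedule.

Section Postponement.

Variables (I : Type) (t r : nat) (out : T -> {ffun T -> option I} -> I).
Hypothesis out_solves : oblivious_solves_consensus e t r out.

Variables (v w : T) (base : schedule).
Hypothesis base_admissible : admissible t r base.
Hypothesis base_relay : forall u, crash base u <= r -> has_relay v base u.
Hypothesis w_correct : r < crash base w.
Hypothesis w_unaware : w \notin informed (delivers base) v r.

Local Notation relay := (relay v base).

Implicit Type inp : T -> I.

Definition postponed s :=
  (forall u, crash base u <= crash s u <= r.+1) /\
  (forall u, crash base u <= r -> crash s u <= crash s (relay u)).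

Definition decision inp s := out w (view e (pattern_of r s) inp w r).

Lemma postponed_valid s : postponed s -> valid_pattern e t (pattern_of r s).
Proof.
case=> s_bounds _; have [base_bounds base_t] := base_admissible.
apply: valid_pattern_of => [|u ur].
  apply: leq_trans base_t; apply/subset_leq_card/subsetP=> u; rewrite !inE.
  by apply: leq_trans; case/andP: (s_bounds u).
have [base_u base_u'] := (s_bounds u, base_bounds u); split; first by lia.
have [|eu _ _] := relayP (base_relay (u := u) _); first by lia.
by apply/set0Pn; exists (relay u); rewrite inE.
Qed.

Lemma postponed_correct s u : postponed s -> r < crash base u -> r < crash s u.
Proof. by case=> /(_ u) /andP[le_u _] _ ru; apply: leq_trans le_u. Qed.

Lemma postponed_no_crash : postponed (no_crash r).
Proof.
have [base_bounds _] := base_admissible; split=> u //=.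
by have := base_bounds u; lia.
Qed.

Lemma postponed_base : postponed base.
Proof.
have [base_bounds _] := base_admissible; split=> u.
  by have := base_bounds u; lia.
by case/base_relay/relayP => _ _ /ltnW.
Qed.

Lemma postponed_later s u c (lost' : T -> {set T}) : postponed s ->
  crash s u <= c <= crash s (relay u) ->
  postponed (Schedule [eta crash s with u |-> c] lost').
Proof.
case=> s_bounds s_relay /andP[uc cu]; split=> z /=.
  have := s_bounds z; have := s_bounds (relay u).
  by case: eqP => [->|_]; lia.
move=> /s_relay; case: (z =P u) => [->|_]; first by case: eqP.
by case: eqP => // ->; lia.
Qed.

Lemma eq_decision_witness inp s s' z :
  postponed s -> postponed s' -> r < crash s z -> r < crash s' z ->
  (forall a, (z \in informed (delivers s) a r) =
             (z \in informed (delivers s') a r)) ->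
  decision inp s = decision inp s'.
Proof.
move=> s_post s'_post sz s'z same.
have witness s1 : postponed s1 -> r < crash s1 z ->
    decision inp s1 = out z (view e (pattern_of r s1) inp z r).
  move=> s1_post s1z.
  have [agree _] := out_solves inp (postponed_valid s1_post).
  apply: agree; rewrite inE -ltnNge //.
  exact: postponed_correct w_correct.
rewrite (witness s) // (witness s') // !view_pattern_of; congr (out z _).
by apply/ffunP=> a; rewrite !ffunE same.
Qed.

Definition agree_until h s s' :=
  forall z, (crash s z <= h) || (crash s' z <= h) ->
    crash s z = crash s' z /\ lost s z = lost s' z.

Definition late_crashes_irrelevant inp h :=
  forall s s', postponed s -> postponed s' -> agree_until h s s' ->
    decision inp s = decision inp s'.

Lemma late_crashes_irrelevant_horizon inp : late_crashes_irrelevant inp r.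
Proof.
move=> s s' s_post s'_post agree.
apply: (@eq_decision_witness _ _ _ w) => // [||a]; try exact: postponed_correct.
rewrite (eq_informed (D' := delivers s')) // => i ir u z; rewrite /delivers.
case: (boolP ((crash s u <= r) || (crash s' u <= r))) => [/agree[-> -> //]|].
by lia.
Qed.

(* The crashes after round [h] are moved back as early as they can be without
   anyone hearing from [v] who does not hear from it in [base]. *)
Definition hasten h s :=
  Schedule
    (fun z => if crash s z <= h then crash s z else maxn h.+1 (crash base z))
    (fun z => if crash s z <= h then lost s z
              else if crash base z <= h then nbhd e z else lost base z).

Lemma postponed_hasten h s : h <= r -> postponed s -> postponed (hasten h s).
Proof.
move=> hr [s_bounds s_relay]; have [base_bounds _] := base_admissible.
split=> u /=.
  by have := s_bounds u; have := base_bounds u; case: ifP; lia.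
move=> ur; have := s_relay u ur; have [_ _] := relayP (base_relay ur).
by case: (leqP (crash s u) h); case: (leqP (crash s (relay u)) h); lia.
Qed.

Lemma agree_until_hasten h s : agree_until h s (hasten h s).
Proof. by move=> z /=; case: (leqP (crash s z) h) => //=; lia. Qed.

Lemma delivers_hasten h s i :
  h < i -> subrel (delivers (hasten h s) i) (delivers base i).
Proof.
move=> hi z y; rewrite /delivers /=.
case: (leqP (crash s z) h) => [sz|_] /and3P[zy]; first by lia.
case: (leqP (crash base z) h) => bz; first by rewrite inE zy implybF; lia.
by rewrite zy (maxn_idPr bz) => -> ->.
Qed.

(* After round [h], whatever the hastened schedule delivers is delivered by
   [base], where [w] learns nothing from the relay of [u]: so [w] does not
   notice whether the relay hears from [u]. *)
Lemma decision_inform_relay inp s u :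
  let h := crash s u in h <= r -> postponed s ->
  decision inp (hasten h s) = decision inp (inform (hasten h s) u (relay u)).
Proof.
move=> h hr s_post; have hastened := postponed_hasten hr s_post.
have uh : crash (hasten h s) u = h by rewrite /= leqnn.
have bu : crash base u <= h by case: s_post => /(_ u) /andP[].
have [_ ru _] := relayP (base_relay (leq_trans bu hr)).
apply: (@eq_decision_witness _ _ _ w) => // [||a]; try exact: postponed_correct.
apply/idP/idP.
  by apply: sub_informed_rel => i _ z y zy; rewrite delivers_inform zy.
case/(@informed_extra_edges _ (delivers (hasten h s)) _ (delivers base) _ v h)
  => //.
- move=> i z y _; rewrite delivers_inform uh.
  case/orP=> [|/and4P[_ /eqP-> /eqP-> _]]; [by left|right; split=> //].
  exact: informed_mono ru.
- move=> i /andP[hi _] z y; rewrite delivers_inform uh => /orP[|/and4P[_ _]].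
    exact: delivers_hasten.
  by lia.
- by rewrite (negbTE w_unaware).
Qed.

(* The relay does not notice whether [u] informs its other neighbours, as it
   learns all that [u] knows. *)
Lemma decision_complete_round inp s u :
  postponed s -> postponed (delay s u) -> crash s u <= r ->
  r < crash s (relay u) -> relay u \notin lost s u ->
  decision inp s = decision inp (delay s u).
Proof.
move=> s_post delay_post ur rr told.
have [/(_ u) /andP[bu _] _] := s_post.
have [base_bounds _] := base_admissible.
have [u_relay _ _] := relayP (base_relay (leq_trans bu ur)).
apply: (eq_decision_witness _ s_post delay_post rr) => [|a].
  exact: leq_trans rr (leq_crash_delay _ _ _).
case ua: (u \in informed (delivers s) a (crash s u).-1); last first.
  by rewrite informed_delay // ua.
have hr : relay u \in informed (delivers s) a r.
  apply: (informed_mono ur); rewrite -(@prednK (crash s u)).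
    apply: (informed_step ua); rewrite /delivers u_relay told implybT.
    by have := base_bounds u; lia.
  by have := base_bounds u; lia.
rewrite hr; apply/esym; apply: sub_informed_rel hr => i _ z y zy.
by rewrite delivers_delay zy.
Qed.

Definition truncate h s :=
  Schedule (fun z => if crash s z < h then crash s z else r.+1) (lost s).

Lemma postponed_truncate h s : postponed s -> postponed (truncate h s).
Proof.
case=> s_bounds s_relay; split=> u /=.
  by have := s_bounds u; case: ifP; lia.
move=> /s_relay; have := s_bounds u; have := s_bounds (relay u).
by case: ifP; case: ifP; lia.
Qed.

Definition spare s u := Schedule [eta crash s with u |-> r.+1] (lost s).

Lemma postponed_spare s u :
  postponed s -> crash s (relay u) = r.+1 -> postponed (spare s u).
Proof.
move=> s_post s_relay; apply: (postponed_later _ s_post).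
by have [/(_ u) /andP[_ ur] _] := s_post; rewrite s_relay leqnn andbT.
Qed.

Lemma crash_truncate h s u :
  h <= crash s u -> crash (truncate h s) u = r.+1.
Proof. by move=> hu; rewrite /= ltnNge hu. Qed.

Lemma decision_spare inp h s u :
  late_crashes_irrelevant inp h -> h <= r -> postponed s -> crash s u = h ->
  h < crash s (relay u) ->
  decision inp s = decision inp (spare (truncate h.+1 s) u).
Proof.
move=> irr hr s_post uh hrel.
pose told := inform (truncate h.+1 s) u (relay u).
have told_u : crash told u = h by rewrite /= uh ltnSn.
have told_relay : crash told (relay u) = r.+1 by apply: crash_truncate.
have told_post : postponed told by apply: (postponed_truncate h.+1 s_post).
have spare_post := postponed_spare told_post told_relay.
have delay_post : postponed (delay told u).
  by apply: postponed_later told_post _; rewrite told_u told_relay leqnSn.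
have hasten_post := postponed_hasten hr s_post.
rewrite (irr _ _ s_post hasten_post (@agree_until_hasten h s)).
have := @decision_inform_relay inp s u; rewrite uh => -> //.
rewrite (irr _ told) // => [|z /=]; last first.
  case: (z =P u) => [->|_]; first by rewrite uh leqnn ltnSn.
  by rewrite ltnS; case: (leqP (crash s z) h) => //=; lia.
rewrite (decision_complete_round inp told_post delay_post) ?told_u //
  ?told_relay //.
  apply: irr => // z; rewrite /delay /spare told_u /=.
  by case: (z =P u) => [->|//]; lia.
by rewrite /= eqxx setD11.
Qed.

(* The relay of [u] crashes later in [base] than [u] does, so the last of the
   nodes considered to crash in [base] has a relay that is not among them. *)
Lemma exists_outliving_relay h s u0 :
  h <= r -> postponed s -> crash s u0 = h ->
  exists2 u, crash s u = h & h < crash s (relay u).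
Proof.
move=> hr [s_bounds s_relay] /eqP u0h.
have [u /eqP uh u_max] :=
  @arg_maxnP _ u0 (fun u => crash s u == h) (crash base) u0h.
exists u => //; have ur : crash base u <= r by have := s_bounds u; lia.
have [_ _ lt_base] := relayP (base_relay ur).
have := s_relay u ur; rewrite uh leq_eqVlt => /predU1P[relh|//].
by have := u_max (relay u); rewrite -relh eqxx => /(_ isT) /=; lia.
Qed.

Lemma decision_truncate inp h s :
  late_crashes_irrelevant inp h -> h <= r -> postponed s ->
  decision inp s = decision inp (truncate h s).
Proof.
move=> irr hr; have [n] := ubnP #|[set u | crash s u == h]|.
elim: n s => // n IH s card_n s_post.
have trunc_post := postponed_truncate h s_post.
case: (pickP (fun u => crash s u == h)) => [u0 u0h|none]; last first.
  apply: irr => // z /=; have := none z.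
  by case: (ltngtP (crash s z) h) => //= _ _; rewrite ltnNge hr.
have [u uh hrel] := exists_outliving_relay hr s_post (eqP u0h).
have spare_post : postponed (spare (truncate h.+1 s) u).
  apply: postponed_spare (crash_truncate hrel).
  exact: postponed_truncate.
rewrite (decision_spare irr hr s_post uh hrel) IH //.
  apply: irr => //; first exact: postponed_truncate.
  move=> z /=; case: (z =P u) => [->|_].
    by rewrite uh ltnn if_same ltnNge hr.
  rewrite ltnS; case: (ltngtP (crash s z) h) => /= zh.
  + by rewrite zh.
  + by rewrite if_same ltnNge hr.
  + by rewrite zh ltnn ltnNge hr.
rewrite -ltnS; apply: leq_trans card_n; rewrite ltnS.
apply/proper_card/properP; split.
  apply/subsetP=> z; rewrite !inE /=.
  by case: (z =P u) => _; [lia|case: ifP; lia].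
by exists u; rewrite inE ?uh //= eqxx; lia.
Qed.

Lemma late_crashes_irrelevantW inp h :
  h.+1 <= r -> late_crashes_irrelevant inp h.+1 ->
  late_crashes_irrelevant inp h.
Proof.
move=> hr irr s s' s_post s'_post agree.
rewrite (decision_truncate irr hr s_post) (decision_truncate irr hr s'_post).
apply: irr; try exact: postponed_truncate.
move=> z /=; have := agree z; rewrite !ltnS.
case: (leqP (crash s z) h) => zh; first by case/(_ isT)=> <- <-; rewrite zh.
case: (leqP (crash s' z) h) => z'h; first by case/(_ isT)=> eq_zz'; lia.
by rewrite ltnNge hr.
Qed.

Lemma late_crashes_irrelevant_all inp h :
  h <= r -> late_crashes_irrelevant inp h.
Proof.
move=> /subKn <-; elim: (r - h) (leq_subr h r) => [|k IH] kr.
  by rewrite subn0; apply: late_crashes_irrelevant_horizon.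
apply: late_crashes_irrelevantW; first by lia.
by have -> : (r - k.+1).+1 = r - k by [lia]; apply/IH/ltnW.
Qed.

Lemma decision_base inp : decision inp base = decision inp (no_crash r).
Proof.
have [base_bounds _] := base_admissible.
apply: (late_crashes_irrelevant_all inp (leq0n r)) => //.
- exact: postponed_base.
- exact: postponed_no_crash.
- by move=> z /=; have := base_bounds z; lia.
Qed.

End Postponement.

Section Radius.

Variable t : nat.

Lemma splits_schedule_of r v phi :
  ecc_finite e phi v -> r < ecc e phi v -> splits r v (schedule_of r phi).
Proof.
rewrite /ecc; case: excluded_middle_informative => // v_fin _.
case: ex_minnP => m /forallP reached m_min rm.
have same i : i <= r -> informed (delivers (schedule_of r phi)) v i =
    informed (pattern_delivers phi) v i.
  by move=> ir; apply: eq_informed => j ji; apply: delivers_schedule_of; lia.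
have /forallPn[w] : ~~ ecc_le e phi v r by apply/negP=> /m_min; lia.
rewrite negb_imply path_within_informed => /andP[w_correct w_unaware].
have := reached w; rewrite w_correct path_within_informed => wm.
have [k [y [z [rk yr /and3P[_ y_alive _]]]]] := informed_progress wm w_unaware.
exists w, y; rewrite same //=; split=> //; first by rewrite (negbTE w_correct).
by move: y_alive; case: ifP => //= _; lia.
Qed.

Lemma admissible_schedule_of r phi :
  valid_pattern e t phi -> admissible t r (schedule_of r phi).
Proof.
case=> card_phi phi_faulty; split=> [u|] /=.
  by case: ifP => [/phi_faulty[]|]; lia.
apply: leq_trans card_phi; apply/subset_leq_card/subsetP=> u; rewrite inE.
by case: ifP => //; lia.
Qed.

Lemma pbP (P : Prop) : reflect P (pb P).
Proof. by rewrite /pb; case: excluded_middle_informative => h; constructor. Qed.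

Lemma lt_radius_ecc r v : lt_radius r (radius e t) ->
  exists2 phi, in_Phi_star e t v phi & r < ecc e phi v.
Proof.
move=> r_lt; apply: NNPP => none.
have bound phi : in_Phi_star e t v phi -> ecc e phi v <= r.
  move=> phi_star; rewrite leqNgt; apply/negP=> lt_ecc.
  by apply: none; exists phi.
have [m mE mr] : exists2 m, max_ecc e t v = Some m & m <= r.
  rewrite /max_ecc; case: excluded_middle_informative => [H|[]]; last first.
    by exists r; apply/pbP.
  by eexists; first reflexivity; case: ex_minnP => m _; apply; apply/pbP.
have attained : [exists v, max_ecc e t v == Some m].
  by apply/existsP; exists v; rewrite mE.
move: r_lt; rewrite /radius.
case: excluded_middle_informative => [H|[]] /=; last by exists m.
by case: ex_minnP => R _ /(_ m attained) Rm; rewrite ltnNge (leq_trans Rm mr).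
Qed.

End Radius.

Lemma decision_independent (I : Type) t r v u
    (out : T -> {ffun T -> option I} -> I) (inp inp' : T -> I) :
  symmetric e -> oblivious_solves_consensus e t r out ->
  lt_radius r (radius e t) -> (forall z, z != v -> inp z = inp' z) ->
  decision r out u inp (no_crash r) = decision r out u inp' (no_crash r).
Proof.
move=> e_sym out_solves r_lt eq_inp.
have [phi [phi_valid v_fin] lt_ecc] := lt_radius_ecc v r_lt.
have [b b_latest] := latest_exists (admissible_schedule_of r phi_valid)
  (splits_schedule_of v_fin lt_ecc).
have [b_adm [w [_ [w_correct w_unaware _ _]]] _] := b_latest.
have b_relay z : crash b z <= r -> has_relay v b z.
  exact: latest_has_relay b_latest.
have to_base inp0 :
    decision r out u inp0 (no_crash r) = decision r out w inp0 b.
  rewrite (decision_base out_solves b_adm b_relay w_correct w_unaware).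
  have [agree _] := out_solves inp0 _ (valid_no_crash t r).
  by apply: agree; rewrite inE /= ltnn.
rewrite !to_base /decision !view_pattern_of; congr (out w _).
apply/ffunP=> z; rewrite !ffunE.
by case: (eqVneq z v) => [->|/eq_inp->//]; rewrite (negbTE w_unaware).
Qed.

End Graph.

Lemma coordinatewise_constant (T : finType) (I J : Type) (v0 : T)
    (F : (T -> I) -> J) :
  (forall v x y, (forall u, u != v -> x u = y u) -> F x = F y) ->
  forall x y, F x = F y.
Proof.
move=> F_indep x y; pose mix (s : seq T) u := if u \in s then y u else x u.
have F_mix s : F (mix s) = F x.
  elim: s => [//|v s <-]; apply: (F_indep v) => u /negbTE uv.
  by rewrite /mix inE uv.
by rewrite -(F_mix (enum T)); apply: (F_indep v0) => u _; rewrite /mix mem_enum.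
Qed.

Theorem theorem1 (T : finType) (e : rel T) (I : Type) (t : nat) :
  symmetric e -> irreflexive e -> (forall x y : T, connect e x y) ->
  2 <= #|T| -> t < kappa e ->
  (exists a b : I, a <> b) ->
  forall (r : nat), lt_radius r (radius e t) ->
  forall out : T -> {ffun T -> option I} -> I,
    ~ oblivious_solves_consensus e t r out.
Proof.
move=> e_sym _ _ T_gt1 _ [a [b ab]] r r_lt out out_solves.
have /card_gt0P[v0 _] : 0 < #|T| by apply: leq_trans T_gt1.
pose failure_free_decision inp := decision e r out v0 inp (no_crash T r).
have decision_const c : failure_free_decision (fun=> c) = c.
  have [_ valid] := out_solves (fun=> c) _ (valid_no_crash e t r).
  by have [|u] := valid v0; rewrite // inE /= ltnn.
apply: ab; rewrite -(decision_const a) -(decision_const b).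
apply: (coordinatewise_constant v0) => v x y.
exact: decision_independent r_lt.
Qed.
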